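(* Let $\dot x=X(x,y)$, $\dot y=Y(x,y)$ be a planar differential system, where $X,Y$ are real polynomials vanishing at the origin. Then any star-like limit cycle $r=F(\theta)$ of this system can be uniquely written as $$r=F(\theta)=f(\sin\theta)+g(\sin\theta)\cos\theta,$$ where $f$ and $g$ are $\mathcal{C}^\infty([-1,1])$.
   Context: Put $r=\sqrt{x^2+y^2}$, $R(x,y)=\big(xX+yY\big)/r$, $T(x,y)=\big(xY-yX\big)/r^2$. In polar coordinates $x=r\cos\theta$, $y=r\sin\theta$ the system becomes $\frac{dr}{d\theta}=\frac{R(r\cos\theta,r\sin\theta)}{T(r\cos\theta,r\sin\theta)}$ where $T\ne0$. A periodic orbit is star-like if it does not intersect $\{T=0\}$; it then corresponds to a smooth $2\pi$-periodic solution $r=F(\theta)$ of this polar equation. A limit cycle is a periodic orbit isolated in the set of periodic orbits. A function belongs to $\mathcal{C}^\infty([-1,1])$ if it is $\mathcal{C}^\infty$ in an open neighborhood of $[-1,1]$; uniqueness is understood for the functions restricted to $[-1,1]$. *)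

(* Defs.v *)
From Stdlib Require Import Reals.
From Coquelicot Require Import Coquelicot.
Open Scope R_scope.

Definition polynomial2 (P : R -> R -> R) : Prop :=
  exists (n : nat) (a : nat -> nat -> R), forall x y : R,
    P x y = sum_n (fun i => sum_n (fun j => a i j * x ^ i * y ^ j) n) n.

Definition is_solution (X Y : R -> R -> R) (x y : R -> R) : Prop :=
  forall t : R,
    is_derive x t (X (x t) (y t)) /\ is_derive y t (Y (x t) (y t)).

(* Orbits are subsets of the plane; equilibria are excluded. *)
Definition periodic_orbit (X Y : R -> R -> R) (G : R * R -> Prop) : Prop :=
  exists (x y : R -> R) (tau : R),
    is_solution X Y x y /\
    0 < tau /\
    (forall t, x (t + tau) = x t /\ y (t + tau) = y t) /\
    (exists t, (x t, y t) <> (x 0, y 0)) /\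
    (forall p, G p <-> exists t, p = (x t, y t)).

(* Isolated: some open neighbourhood of the orbit contains no other periodic
   orbit. *)
Definition limit_cycle (X Y : R -> R -> R) (G : R * R -> Prop) : Prop :=
  periodic_orbit X Y G /\
  exists U : R * R -> Prop,
    open U /\
    (forall p, G p -> U p) /\
    (forall G' : R * R -> Prop,
       periodic_orbit X Y G' -> (forall p, G' p -> U p) ->
       forall p, G' p <-> G p).

(* The angular speed d theta / dt along the flow. Division being total, it is 0
   at the origin; this is immaterial when X and Y vanish there, since no
   periodic orbit then passes through the origin. *)
Definition angular_speed (X Y : R -> R -> R) (x y : R) : R :=
  (x * Y x y - y * X x y) / (sqrt (x ^ 2 + y ^ 2)) ^ 2.

Definition star_like (X Y : R -> R -> R) (G : R * R -> Prop) : Prop :=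
  forall x y, G (x, y) -> angular_speed X Y x y <> 0.

(* G is the curve r = F(theta) in polar coordinates, with r > 0. When G is a
   star-like periodic orbit, this determines F, which is then smooth and solves
   the polar form of the system: neither fact is assumed. *)
Definition polar_curve (F : R -> R) (G : R * R -> Prop) : Prop :=
  (forall theta, 0 < F theta) /\
  (forall theta, F (theta + 2 * PI) = F theta) /\
  (forall x y, G (x, y) <->
     exists theta, x = F theta * cos theta /\ y = F theta * sin theta).

Definition smooth_on_m1_1 (f : R -> R) : Prop :=
  exists U : R -> Prop,
    open U /\
    (forall x, -1 <= x <= 1 -> U x) /\
    (forall (n : nat) x, U x -> ex_derive_n f n x).

Definition sin_cos_form (F f g : R -> R) : Prop :=
  smooth_on_m1_1 f /\ smooth_on_m1_1 g /\
  forall theta, F theta = f (sin theta) + g (sin theta) * cos theta.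

(* Main.v *)
Require Import Defs.
From Stdlib Require Import Reals Lra Lia List Factorial Ranalysis5.
From Coquelicot Require Import Coquelicot.
Open Scope R_scope.

(** Regularity of F comes first. Near each of its points the orbit is a
    parametrised curve whose polar angle has nonzero speed, so F is the radius
    composed with the inverse of the angle, and it solves the polar equation
    F' = F N / W, where N = cos X + sin Y and W = cos Y - sin X are taken on
    the curve and W has no zero (polar_equation).

    For |s| < 1 the values f(s) and g(s) are forced: they are the half sum of
    F(theta) and F(PI - theta) for theta = asin s, and their half difference
    divided by cos theta. All the difficulty is smoothness up to and beyond
    s = 1 and s = -1, where asin is not differentiable. Near theta = alpha put
    p = tan ((theta - alpha) / 2) and Phi(p) = F(alpha + 2 atan p). For
    alpha = PI/2 one has
      sin theta = (1 - p^2) / (1 + p^2)   and   p = - cos theta / (1 + sin theta),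
    so that p^2 = (1 - s) / (1 + s) is a smooth function of s = sin theta on
    all of s > -1. If Phi(p) = H(p^2) + p K(p^2), then f(s) = H((1-s)/(1+s))
    and g(s) = - K((1-s)/(1+s)) / (1+s). These are smooth beyond s = 1 as soon
    as H and K are smooth on an interval (-d, oo) with d > 0; alpha = -PI/2
    serves s = -1, and the two pairs agree on (-1, 1) by uniqueness.

    The existence of H and K on negative arguments uses that Phi is a
    convergent power series at 0: H and K are continued by the series of the
    even and of the odd coefficients (even_odd_parts). Analyticity of Phi comes
    from the polynomial nature of the system. The functions
    C = cos(alpha + 2 atan p), S = sin(alpha + 2 atan p), Phi and Q = 1/W have
    derivatives that are polynomials in C, S, Phi, Q. Differentiating a
    polynomial of degree e in them, with coefficients of total size c, gives
    one of degree at most e + d and size at most e A c, where 1 + d and A bound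
    the degree and the size of the four derivatives. Hence the n-th derivative
    of Phi is at most M B^n n! on a neighbourhood of 0
    (differential_ring_analytic).

    Uniqueness at s = 1 and s = -1 follows by continuity. *)

(** * Differentiability of order n on an open set *)

(** The recursion is on the derivative, so that stability under products,
    composition, etc., is an induction on n that uses only the rules for first
    derivatives. *)
Fixpoint Cn (n : nat) (U : R -> Prop) (f : R -> R) : Prop :=
  match n with
  | O => True
  | S m => (forall x, U x -> ex_derive f x) /\ Cn m U (Derive f)
  end.

Definition smooth (U : R -> Prop) (f : R -> R) : Prop := forall n, Cn n U f.

Lemma locally_open (U : R -> Prop) (P : R -> Prop) (x : R) :
  open U -> U x -> (forall y, U y -> P y) -> locally x P.
Proof.
intros oU Ux h; generalize (oU x Ux); apply filter_imp; exact h.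
Qed.

Lemma Cn_ext n U f g :
  open U -> (forall x, U x -> f x = g x) -> Cn n U f -> Cn n U g.
Proof.
intros oU; revert f g; induction n as [|n IH]; intros f g e; [easy|].
intros [h1 h2]; split.
- intros x Ux; apply (ex_derive_ext_loc f); [|now apply h1].
  now apply (locally_open U).
- apply IH with (2 := h2); intros x Ux; apply Derive_ext_loc.
  now apply (locally_open U).
Qed.

(** Allows the derivative to be given by any formula valid on U. *)
Lemma Cn_intro n U f f' :
  open U -> (forall x, U x -> is_derive f x (f' x)) -> Cn n U f' ->
  Cn (S n) U f.
Proof.
intros oU h c; split.
- intros x Ux; now exists (f' x); apply h.
- apply Cn_ext with (3 := c); [easy|].
  intros x Ux; symmetry; apply is_derive_unique; now apply h.
Qed.

Lemma Cn_pred n U f : Cn (S n) U f -> Cn n U f.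
Proof.
revert f; induction n as [|n IH]; intros f; [easy|].
intros [h1 h2]; split; [easy|now apply IH].
Qed.

Lemma Cn_sub n (U V : R -> Prop) f :
  (forall x, V x -> U x) -> Cn n U f -> Cn n V f.
Proof.
intros h; revert f; induction n as [|n IH]; intros f; [easy|].
intros [h1 h2]; split; auto.
Qed.

Lemma Cn_union n (U V : R -> Prop) f :
  Cn n U f -> Cn n V f -> Cn n (fun x => U x \/ V x) f.
Proof.
revert f; induction n as [|n IH]; intros f; [easy|].
intros [h1 h2] [h3 h4]; split; [intros x [u|v]; auto|auto].
Qed.

Lemma Cn_const n U a : open U -> Cn n U (fun _ => a).
Proof.
intros oU; revert a; induction n as [|n IH]; intros a; [easy|].
apply Cn_intro with (fun _ => 0); auto.
intros x _; apply (is_derive_const a x).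
Qed.

Lemma Cn_id n U : open U -> Cn n U (fun x => x).
Proof.
intros oU; destruct n as [|n]; [easy|].
apply Cn_intro with (fun _ => 1); [easy| |now apply Cn_const].
intros x _; apply (is_derive_id x).
Qed.

Lemma Cn_plus n U f g :
  open U -> Cn n U f -> Cn n U g -> Cn n U (fun x => f x + g x).
Proof.
intros oU; revert f g; induction n as [|n IH]; intros f g; [easy|].
intros [h1 h2] [h3 h4].
apply Cn_intro with (fun x => Derive f x + Derive g x); auto.
intros x Ux; apply (is_derive_plus f g); apply Derive_correct; auto.
Qed.

Lemma Cn_mult n U f g :
  open U -> Cn n U f -> Cn n U g -> Cn n U (fun x => f x * g x).
Proof.
intros oU; revert f g; induction n as [|n IH]; intros f g; [easy|].
intros hf hg.
assert (hf' := Cn_pred _ _ _ hf); assert (hg' := Cn_pred _ _ _ hg).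
destruct hf as [h1 h2], hg as [h3 h4].
apply Cn_intro with (fun x => Derive f x * g x + f x * Derive g x);
  [easy| |now apply Cn_plus; auto].
intros x Ux; apply (is_derive_mult f g); try (apply Derive_correct; auto).
intros; apply Rmult_comm.
Qed.

Lemma Cn_comp n (U V : R -> Prop) f g :
  open U -> (forall x, U x -> V (g x)) ->
  Cn n V f -> Cn n U g -> Cn n U (fun x => f (g x)).
Proof.
intros oU hUV; revert f g hUV; induction n as [|n IH]; intros f g hUV; [easy|].
intros hf hg; assert (hg' := Cn_pred _ _ _ hg).
destruct hf as [h1 h2], hg as [h3 h4].
apply Cn_intro with (fun x => Derive g x * Derive f (g x)); [easy| |].
- intros x Ux; apply (is_derive_comp f g); apply Derive_correct; auto.
- apply Cn_mult; auto.
Qed.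

Lemma Cn_inv n : Cn n (fun x => x <> 0) Rinv.
Proof.
induction n as [|n IH]; [easy|].
apply Cn_intro with (fun x => (-1) * (/ x * / x)).
- apply (open_neq 0).
- intros x hx; auto_derive; [easy|now field].
- repeat apply Cn_mult; try apply (open_neq 0); try easy.
  apply Cn_const, (open_neq 0).
Qed.

Lemma Cn_div n U f g :
  open U -> (forall x, U x -> g x <> 0) ->
  Cn n U f -> Cn n U g -> Cn n U (fun x => f x / g x).
Proof.
intros oU h hf hg; apply Cn_mult; auto.
apply (Cn_comp n U (fun x => x <> 0) Rinv g); auto; apply Cn_inv.
Qed.

Lemma Cn_sqrt n : Cn n (fun x => 0 < x) sqrt.
Proof.
induction n as [|n IH]; [easy|].
assert (oU : open (fun x => 0 < x)) by apply open_gt.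
apply Cn_intro with (fun x => (/ 2) / sqrt x); [easy| |].
- intros x hx; auto_derive; [easy|].
  field; apply Rgt_not_eq, sqrt_lt_R0; easy.
- apply Cn_div; auto; [|now apply Cn_const].
  intros x hx; apply Rgt_not_eq, sqrt_lt_R0; easy.
Qed.

Lemma Cn_PSeries n a : Cn n (fun x => Rbar_lt (Rabs x) (CV_radius a)) (PSeries a).
Proof.
assert (oU : forall a, open (fun x => Rbar_lt (Rabs x) (CV_radius a))).
{ clear; intros a; destruct (CV_radius a) as [r| |]; simpl.
  - intros x hx.
    assert (0 < r - Rabs x) by lra.
    exists (mkposreal _ H); intros y hy.
    change (Rabs (y - x) < r - Rabs x) in hy.
    replace y with ((y - x) + x) by ring.
    apply Rle_lt_trans with (1 := Rabs_triang _ _); lra.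
  - apply open_true.
  - apply open_false. }
revert a; induction n as [|n IH]; intros a; [easy|].
apply Cn_intro with (PSeries (PS_derive a)); [easy| |].
- intros x hx; now apply is_derive_PSeries.
- rewrite <- (CV_radius_derive a); apply IH.
Qed.

(** [ex_derive_n] differentiates last what [Cn] differentiates first. *)
Lemma Cn_ex_derive_n n U f x : Cn n U f -> U x -> ex_derive_n f n x.
Proof.
intros h Ux; revert f h; induction n as [|n IH]; intros f; [easy|].
intros [h1 h2]; destruct n as [|n]; [now apply h1|].
simpl; apply (ex_derive_ext (Derive_n (Derive f) n)).
- intros t; change (Derive f) with (Derive_n f 1).
  rewrite Derive_n_comp; replace (n + 1)%nat with (S n) by lia; easy.
- exact (IH (Derive f) h2).
Qed.

(** * Even and odd parts as functions of the square *)

Lemma geometric_CV_radius (a : nat -> R) (M B : R) :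
  0 < B -> (forall k, Rabs (a k) <= M * B ^ k) ->
  forall x, Rabs x < / B -> Rbar_lt (Rabs x) (CV_radius a).
Proof.
intros hB ha x hx.
apply Rbar_lt_le_trans with (/ B); [exact hx|].
apply (CV_radius_bounded a); exists M; intros n.
rewrite Rabs_mult, pow_inv, (Rabs_right (/ B ^ n)).
- apply Rmult_le_reg_r with (B ^ n); [now apply pow_lt|].
  rewrite Rmult_assoc, Rinv_l, Rmult_1_r; [apply ha|].
  apply pow_nonzero; lra.
- apply Rle_ge, Rlt_le, Rinv_0_lt_compat; now apply pow_lt.
Qed.

Lemma PSeries_even_odd (a : nat -> R) (M B : R) :
  0 < B -> (forall k, Rabs (a k) <= M * B ^ k) ->
  let ae := fun n => a (2 * n)%nat in
  let ao := fun n => a (2 * n + 1)%nat in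
  (forall w, Rabs w < / (B * B) -> Rbar_lt (Rabs w) (CV_radius ae)) /\
  (forall w, Rabs w < / (B * B) -> Rbar_lt (Rabs w) (CV_radius ao)) /\
  (forall p, Rabs p < / B ->
     PSeries a p = PSeries ae (p * p) + p * PSeries ao (p * p)).
Proof.
intros hB ha ae ao.
assert (hBB : 0 < B * B) by nra.
assert (pw : forall n, (B * B) ^ n = B ^ (2 * n)).
{ intros n; rewrite pow_mult; f_equal; ring. }
assert (he : forall w, Rabs w < / (B * B) -> Rbar_lt (Rabs w) (CV_radius ae)).
{ apply geometric_CV_radius with M; [easy|]; intros k; rewrite pw; apply ha. }
assert (ho : forall w, Rabs w < / (B * B) -> Rbar_lt (Rabs w) (CV_radius ao)).
{ apply geometric_CV_radius with (M * B); [easy|]; intros k; rewrite pw.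
  apply Rle_trans with (1 := ha _); rewrite pow_add; apply Req_le; ring. }
repeat split; auto.
intros p hp.
assert (hpp : Rabs (p ^ 2) < / (B * B)).
{ rewrite <- RPow_abs, Rinv_mult; simpl; rewrite Rmult_1_r.
  apply Rmult_le_0_lt_compat; auto using Rabs_pos. }
replace (p * p) with (p ^ 2) by ring.
apply PSeries_odd_even; apply CV_disk_correct, CV_disk_inside; [now apply he|now apply ho].
Qed.

Lemma open_Ioo a b : open (fun x => a < x < b).
Proof. apply open_and; [apply open_gt|apply open_lt]. Qed.

Lemma smooth_glue_pos (d : R) (h1 h2 : R -> R) :
  0 < d ->
  smooth (fun w => - d < w < d) h1 -> smooth (fun w => 0 < w) h2 ->
  (forall w, 0 < w < d -> h1 w = h2 w) ->
  smooth (fun w => - d < w) (fun w => if Rle_dec w 0 then h1 w else h2 w).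
Proof.
intros hd s1 s2 e n.
apply Cn_sub with (fun w => (- d < w < d) \/ 0 < w).
{ intros w hw; destruct (Rlt_dec 0 w); [now right|left; lra]. }
apply Cn_union.
- apply Cn_ext with h1; auto; [apply open_Ioo|].
  intros w hw; destruct (Rle_dec w 0); [easy|apply e; lra].
- apply Cn_ext with h2; auto; [apply open_gt|].
  intros w hw; destruct (Rle_dec w 0); [lra|easy].
Qed.

(** On w > 0 the functions H and K are (Phi(sqrt w) + Phi(- sqrt w)) / 2 and
    (Phi(sqrt w) - Phi(- sqrt w)) / (2 sqrt w), which are smooth there but
    whose smoothness at 0 is not visible. Near 0 they coincide with the series
    of the even and of the odd coefficients, which are defined on both sides of
    0 and provide both the smoothness and the continuation to w < 0. *)
Theorem even_odd_parts (Phi : R -> R) (a : nat -> R) (M B : R) :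
  smooth (fun _ => True) Phi ->
  0 < B -> (forall k, Rabs (a k) <= M * B ^ k) ->
  (forall p, Rabs p < / B -> Phi p = PSeries a p) ->
  exists (H K : R -> R) (d : R), 0 < d /\
    smooth (fun w => - d < w) H /\ smooth (fun w => - d < w) K /\
    forall p, Phi p = H (p * p) + p * K (p * p).
Proof.
intros sPhi hB ha hPhi.
destruct (PSeries_even_odd a M B hB ha) as (he & ho & heo).
set (ae := fun n => a (2 * n)%nat) in *.
set (ao := fun n => a (2 * n + 1)%nat) in *.
set (d := / (B * B)) in *.
assert (hd : 0 < d) by (apply Rinv_0_lt_compat; nra).
set (h := fun w => (Phi (sqrt w) + Phi (- 1 * sqrt w)) * / 2).
set (k := fun w => (Phi (sqrt w) + -1 * Phi (- 1 * sqrt w)) / (2 * sqrt w)).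
assert (oU : open (fun w => 0 < w)) by apply open_gt.
assert (near : forall w, 0 < w < d ->
  Phi (sqrt w) = PSeries ae w + sqrt w * PSeries ao w /\
  Phi (-1 * sqrt w) = PSeries ae w - sqrt w * PSeries ao w).
{ intros w hw.
  assert (hs : sqrt w < / B).
  { replace (/ B) with (sqrt d); [apply sqrt_lt_1; lra|].
    unfold d; rewrite Rinv_mult; apply sqrt_square.
    now apply Rlt_le, Rinv_0_lt_compat. }
  assert (hp := sqrt_pos w).
  assert (hq : sqrt w * sqrt w = w) by (apply sqrt_sqrt; lra).
  assert (hq' : -1 * sqrt w * (-1 * sqrt w) = w) by (rewrite <- hq at 3; ring).
  split; rewrite hPhi, heo by (apply Rabs_def1; lra).
  - now rewrite hq.
  - rewrite hq'; ring. }
assert (sub : forall b, (forall w, Rabs w < d -> Rbar_lt (Rabs w) (CV_radius b)) ->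
  smooth (fun w => - d < w < d) (PSeries b)).
{ intros b hb n; apply Cn_sub with (2 := Cn_PSeries n b).
  intros w hw; apply hb; apply Rabs_def1; lra. }
assert (ssq : forall n, Cn n (fun w => 0 < w) (fun w => Phi (sqrt w))).
{ intros n; apply (Cn_comp n _ (fun _ => True) Phi sqrt); auto; apply Cn_sqrt. }
assert (ssq' : forall n, Cn n (fun w => 0 < w) (fun w => Phi (-1 * sqrt w))).
{ intros n; apply (Cn_comp n _ (fun _ => True) Phi); auto.
  apply Cn_mult; auto; [now apply Cn_const|apply Cn_sqrt]. }
exists (fun w => if Rle_dec w 0 then PSeries ae w else h w),
  (fun w => if Rle_dec w 0 then PSeries ao w else k w), d.
split; [easy|split; [|split]].
- apply smooth_glue_pos; auto.
  + intros n; apply Cn_mult; [easy| |now apply Cn_const].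
    apply Cn_plus; auto.
  + intros w hw; unfold h; destruct (near w hw) as [-> ->]; field.
- apply smooth_glue_pos; auto.
  + intros n; apply Cn_div; auto.
    * intros w hw; assert (hp := sqrt_lt_R0 w hw); lra.
    * apply Cn_plus; auto; apply Cn_mult; auto; now apply Cn_const.
    * apply Cn_mult; auto; [now apply Cn_const|apply Cn_sqrt].
  + intros w hw; unfold k; destruct (near w hw) as [-> ->]; field.
    assert (hp := sqrt_lt_R0 w (proj1 hw)); lra.
- intros p; destruct (Rle_dec (p * p) 0) as [hp|hp].
  + assert (p = 0) as -> by nra.
    rewrite hPhi, heo; auto; rewrite Rabs_R0; now apply Rinv_0_lt_compat.
  + unfold h, k; destruct (Rle_dec 0 p) as [p0|p0].
    * rewrite sqrt_square by easy; field; nra.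
    * replace (p * p) with ((- p) * (- p)) by ring.
      rewrite sqrt_square by lra.
      replace (-1 * - p) with p by ring; field; nra.
Qed.

(** * Solutions of polynomial differential systems are analytic *)

(** The degree bound e and the bound c on the sum of the absolute values of
    the coefficients are carried by the way f is built, so that they can be
    followed through differentiation without any normal form for polynomials
    in several functions. *)
Inductive poly_in (l : list (R -> R)) : nat -> R -> (R -> R) -> Prop :=
| poly_const a : poly_in l 0 (Rabs a) (fun _ => a)
| poly_gen v : In v l -> poly_in l 1 1 v
| poly_plus e c1 c2 f g : poly_in l e c1 f -> poly_in l e c2 g ->
    poly_in l e (c1 + c2) (fun x => f x + g x)
| poly_mult e1 e2 c1 c2 f g : poly_in l e1 c1 f -> poly_in l e2 c2 g ->
    poly_in l (e1 + e2) (c1 * c2) (fun x => f x * g x)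
| poly_weaken e e' c c' f g : (e <= e')%nat -> c <= c' ->
    (forall x, f x = g x) -> poly_in l e c f -> poly_in l e' c' g.

Definition in_ring (l : list (R -> R)) (f : R -> R) : Prop :=
  exists e c, poly_in l e c f.

Lemma poly_norm_pos l e c f : poly_in l e c f -> 0 <= c.
Proof.
induction 1; try lra; [apply Rabs_pos|now apply Rmult_le_pos].
Qed.

Lemma in_ring_const l a : in_ring l (fun _ => a).
Proof. exists 0%nat, (Rabs a); apply poly_const. Qed.

Lemma in_ring_gen l v : In v l -> in_ring l v.
Proof. exists 1%nat, 1; now apply poly_gen. Qed.

Lemma in_ring_ext l f g : (forall x, f x = g x) -> in_ring l f -> in_ring l g.
Proof.
intros h (e & c & p); exists e, c; apply poly_weaken with (4 := p); auto; lra.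
Qed.

Lemma in_ring_plus l f g :
  in_ring l f -> in_ring l g -> in_ring l (fun x => f x + g x).
Proof.
intros (e & c & p) (e' & c' & p'); exists (e + e')%nat, (c + c').
apply poly_plus; [apply poly_weaken with (4 := p)|apply poly_weaken with (4 := p')];
  auto; lia || lra.
Qed.

Lemma in_ring_mult l f g :
  in_ring l f -> in_ring l g -> in_ring l (fun x => f x * g x).
Proof.
intros (e & c & p) (e' & c' & p'); exists (e + e')%nat, (c * c').
now apply poly_mult.
Qed.

Lemma in_ring_pow l f n : in_ring l f -> in_ring l (fun x => f x ^ n).
Proof.
intros h; induction n as [|n IH]; [exact (in_ring_const l 1)|].
exact (in_ring_mult l f (fun x => f x ^ n) h IH).
Qed.

Lemma in_ring_sum l (F : nat -> R -> R) n :
  (forall i, in_ring l (F i)) -> in_ring l (fun x => sum_n (fun i => F i x) n).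
Proof.
intros h; induction n as [|n IH].
- apply in_ring_ext with (F 0%nat); auto; intros x; now rewrite sum_O.
- apply in_ring_ext with (fun x => sum_n (fun i => F i x) n + F (S n) x).
  + intros x; now rewrite sum_Sn.
  + now apply in_ring_plus.
Qed.

Lemma in_ring_polynomial2 l P f g :
  polynomial2 P -> in_ring l f -> in_ring l g ->
  in_ring l (fun x => P (f x) (g x)).
Proof.
intros (n & a & hP) hf hg.
apply in_ring_ext with (fun x => sum_n (fun i =>
  sum_n (fun j => a i j * f x ^ i * g x ^ j) n) n).
{ intros x; now rewrite hP. }
apply (in_ring_sum l (fun i x => sum_n (fun j => a i j * f x ^ i * g x ^ j) n)).
intros i; apply (in_ring_sum l (fun j x => a i j * f x ^ i * g x ^ j)); intros j.
repeat apply in_ring_mult; auto using in_ring_pow, in_ring_const.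
Qed.

Definition derivable_in (l : list (R -> R)) (f : R -> R) : Prop :=
  exists f', (forall x, is_derive f x (f' x)) /\ in_ring l f'.

(** The lists l and l' differ because the derivative of the reciprocal of a
    polynomial in l is a polynomial only once this reciprocal is itself adjoined
    to l. *)
Lemma derivable_in_ring l l' :
  incl l l' -> (forall v, In v l -> derivable_in l' v) ->
  forall f, in_ring l f -> derivable_in l' f.
Proof.
intros hl hd f (e & c & p).
assert (mono : forall e c f, poly_in l e c f -> in_ring l' f).
{ clear -hl; induction 1.
  - apply in_ring_const.
  - now apply in_ring_gen, hl.
  - now apply in_ring_plus.
  - now apply in_ring_mult.
  - now apply in_ring_ext with f. }
induction p as [a|v hv|e c1 c2 f g hf IHf hg IHg
  |e1 e2 c1 c2 f g hf IHf hg IHg|e e' c c' f g _ _ h hf IHf].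
- exists (fun _ => 0); split; [intros x; apply (is_derive_const a x)|apply in_ring_const].
- now apply hd.
- destruct IHf as (f' & df & rf), IHg as (g' & dg & rg).
  exists (fun x => f' x + g' x); split; [|now apply in_ring_plus].
  intros x; now apply (is_derive_plus f g).
- destruct IHf as (f' & df & rf), IHg as (g' & dg & rg).
  exists (fun x => f' x * g x + f x * g' x); split.
  + intros x; apply (is_derive_mult f g); auto; intros; apply Rmult_comm.
  + apply in_ring_plus; apply in_ring_mult; eauto.
- destruct IHf as (f' & df & rf); exists f'; split; auto.
  intros x; apply is_derive_ext with (2 := df x); auto.
Qed.

(** The derivative of a monomial of degree e is a sum of e terms, each of which
    replaces one factor by a polynomial of degree 1 + d and size A. *)
Lemma poly_derive l d A :
  0 <= A ->
  (forall v, In v l -> exists v', (forall x, is_derive v x (v' x)) /\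
     poly_in l (S d) A v') ->
  forall e c f, poly_in l e c f ->
    exists f', (forall x, is_derive f x (f' x)) /\
      poly_in l (e + d) (INR e * A * c) f'.
Proof.
intros hA hd; induction 1 as [a|v hv|e c1 c2 f g hf IHf hg IHg
  |e1 e2 c1 c2 f g hf IHf hg IHg|e e' c c' f g he hc h hf IHf].
- exists (fun _ => 0); split; [intros x; apply (is_derive_const a x)|].
  apply poly_weaken with (4 := poly_const l 0); auto; [lia|].
  rewrite Rabs_R0; simpl; lra.
- destruct (hd v hv) as (v' & dv & pv); exists v'; split; auto.
  apply poly_weaken with (4 := pv); auto; simpl; lra.
- destruct IHf as (f' & df & pf), IHg as (g' & dg & pg).
  exists (fun x => f' x + g' x); split.
  + intros x; now apply (is_derive_plus f g).
  + rewrite Rmult_plus_distr_l; now apply poly_plus.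
- destruct IHf as (f' & df & pf), IHg as (g' & dg & pg).
  exists (fun x => f' x * g x + f x * g' x); split.
  + intros x; apply (is_derive_mult f g); auto; intros; apply Rmult_comm.
  + replace (INR (e1 + e2) * A * (c1 * c2)) with
      ((INR e1 * A * c1) * c2 + c1 * (INR e2 * A * c2))
      by (rewrite plus_INR; ring).
    apply poly_plus.
    * apply poly_weaken with (4 := poly_mult _ _ _ _ _ _ _ pf hg); auto;
        lia || apply Rle_refl.
    * apply poly_weaken with (4 := poly_mult _ _ _ _ _ _ _ hf pg); auto;
        lia || apply Rle_refl.
- destruct IHf as (f' & df & pf); exists f'; split.
  + intros x; apply is_derive_ext with (2 := df x); auto.
  + apply poly_weaken with (4 := pf); auto; [lia|].
    assert (h0 := poly_norm_pos _ _ _ _ hf).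
    assert (h1 := pos_INR e); assert (h2 := le_INR _ _ he).
    apply Rmult_le_compat; auto; [now apply Rmult_le_pos|].
    now apply Rmult_le_compat_r.
Qed.

(** The factorial comes from the degrees: the k-th differentiation multiplies
    the size by at most A (e + k d) <= A (e + d) (k + 1). *)
Lemma poly_Derive_n l d A :
  0 <= A ->
  (forall v, In v l -> exists v', (forall x, is_derive v x (v' x)) /\
     poly_in l (S d) A v') ->
  forall e c f, poly_in l e c f ->
  forall n, exists fn, (forall x, Derive_n f n x = fn x) /\
    poly_in l (e + n * d) (c * (A * INR (e + d)) ^ n * INR (fact n)) fn.
Proof.
intros hA hd e c f pf n.
assert (hc := poly_norm_pos _ _ _ _ pf).
induction n as [|n (fn & efn & pfn)].
- exists f; split; auto; apply poly_weaken with (4 := pf); auto; [lia|simpl; lra].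
- destruct (poly_derive l d A hA hd _ _ _ pfn) as (g & dg & pg).
  exists g; split.
  + intros x; simpl; rewrite (Derive_ext _ _ _ efn); now apply is_derive_unique.
  + apply poly_weaken with (4 := pg); auto; [simpl; lia|].
    assert (hn : INR (e + n * d) <= INR (S n) * INR (e + d)).
    { rewrite <- mult_INR; apply le_INR; nia. }
    assert (hk : 0 <= c * (A * INR (e + d)) ^ n * INR (fact n)).
    { apply Rmult_le_pos; [apply Rmult_le_pos; auto|apply pos_INR].
      apply pow_le, Rmult_le_pos; auto; apply pos_INR. }
    apply Rle_trans with (INR (S n) * INR (e + d) * A *
      (c * (A * INR (e + d)) ^ n * INR (fact n))).
    * apply Rmult_le_compat_r; auto; now apply Rmult_le_compat_r.
    * rewrite fact_simpl, mult_INR, <- tech_pow_Rmult; apply Req_le; ring.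
Qed.

Lemma poly_bound l e c f (I : R -> Prop) M :
  1 <= M -> (forall v, In v l -> forall x, I x -> Rabs (v x) <= M) ->
  poly_in l e c f -> forall x, I x -> Rabs (f x) <= c * M ^ e.
Proof.
intros hM hl; induction 1 as [a|v hv|e c1 c2 f g hf IHf hg IHg
  |e1 e2 c1 c2 f g hf IHf hg IHg|e e' c c' f g he hc h hf IHf]; intros x Ix.
- simpl; lra.
- rewrite pow_1, Rmult_1_l; auto.
- rewrite Rmult_plus_distr_r; apply Rle_trans with (1 := Rabs_triang _ _).
  apply Rplus_le_compat; auto.
- rewrite Rabs_mult, pow_add.
  replace (c1 * c2 * (M ^ e1 * M ^ e2)) with ((c1 * M ^ e1) * (c2 * M ^ e2)) by ring.
  apply Rmult_le_compat; auto using Rabs_pos.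
- rewrite <- h; apply Rle_trans with (1 := IHf x Ix).
  apply Rmult_le_compat; auto.
  + now apply poly_norm_pos in hf.
  + apply pow_le; lra.
  + now apply Rle_pow.
Qed.

Lemma derivable_in_uniform l l' :
  (forall v, In v l' -> derivable_in l v) ->
  exists d A, 0 <= A /\ forall v, In v l' ->
    exists v', (forall x, is_derive v x (v' x)) /\ poly_in l (S d) A v'.
Proof.
induction l' as [|u l' IH]; intros h.
- exists 0%nat, 0; split; [lra|easy].
- destruct IH as (d & A & hA & IH); [intros v hv; apply h; now right|].
  destruct (h u (or_introl eq_refl)) as (u' & du & e & c & pu).
  assert (hc := poly_norm_pos _ _ _ _ pu).
  exists (d + e)%nat, (A + c); split; [lra|].
  intros v [<-|hv].
  + exists u'; split; auto; apply poly_weaken with (4 := pu); auto; lia || lra.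
  + destruct (IH v hv) as (v' & dv & pv); exists v'; split; auto.
    apply poly_weaken with (4 := pv); auto; lia || lra.
Qed.

Lemma bounded_uniform (l : list (R -> R)) a b :
  a <= b -> (forall v, In v l -> forall x, ex_derive v x) ->
  exists M, 1 <= M /\
    forall v, In v l -> forall x, a <= x <= b -> Rabs (v x) <= M.
Proof.
intros hab; induction l as [|u l IH]; intros h; [exists 1; split; [lra|easy]|].
destruct IH as (M & hM & IH); [intros v hv; apply h; now right|].
destruct (continuity_ab_maj (fun x => Rabs (u x)) a b hab) as (m & hm & _).
{ intros x _; apply (continuity_pt_comp u Rabs); [|apply Rcontinuity_abs].
  apply continuity_pt_filterlim, (ex_derive_continuous u x), h; now left. }
exists (M + Rabs (u m)); assert (h0 := Rabs_pos (u m)); split; [lra|].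
intros v [<-|hv] x hx; [specialize (hm x hx)|specialize (IH v hv x hx)]; lra.
Qed.

Lemma taylor_remainder (f : R -> R) (M B : R) :
  (forall n x, ex_derive_n f n x) ->
  (forall n x, -1 <= x <= 1 -> Rabs (Derive_n f n x) <= M * B ^ n * INR (fact n)) ->
  forall p n, 0 < p <= 1 ->
  Rabs (f p - sum_f_R0 (fun k => p ^ k / INR (fact k) * Derive_n f k 0) n)
    <= M * (B * p) ^ S n.
Proof.
intros hf hb p n hp.
destruct (Taylor_Lagrange f n 0 p) as (z & hz & ->); [easy|auto|].
rewrite Rminus_0_r.
match goal with |- Rabs (?a + ?b - ?a) <= _ =>
  replace (a + b - a) with b by ring end.
assert (hF := INR_fact_lt_0 (S n)).
assert (hP : 0 < p ^ S n) by now apply pow_lt.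
rewrite Rabs_mult, Rabs_right
  by (apply Rle_ge, Rlt_le, Rdiv_lt_0_compat; auto).
apply Rle_trans with (p ^ S n / INR (fact (S n)) * (M * B ^ S n * INR (fact (S n)))).
- apply Rmult_le_compat_l; [apply Rlt_le, Rdiv_lt_0_compat; auto|].
  apply hb; lra.
- rewrite Rpow_mult_distr; apply Req_le; field; lra.
Qed.

(** The Taylor remainder is at most M (B |p|)^(n+1). The radius is 1 / (B + 1)
    and not 1 / B, which keeps p inside [-1, 1], where the bounds hold. *)
Lemma derivative_bounds_analytic (f : R -> R) (M B : R) :
  0 <= B ->
  (forall n x, ex_derive_n f n x) ->
  (forall n x, -1 <= x <= 1 -> Rabs (Derive_n f n x) <= M * B ^ n * INR (fact n)) ->
  let a := fun k => Derive_n f k 0 / INR (fact k) in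
  (forall k, Rabs (a k) <= M * (B + 1) ^ k) /\
  (forall p, Rabs p < / (B + 1) -> f p = PSeries a p).
Proof.
intros hB hf hb a.
assert (hM : 0 <= M).
{ assert (h := hb 0%nat 0); simpl in h.
  assert (h0 := Rabs_pos (f 0)); lra. }
split.
- intros k; unfold a, Rdiv; rewrite Rabs_mult.
  assert (hF := INR_fact_lt_0 k).
  rewrite (Rabs_right (/ _)) by (apply Rle_ge, Rlt_le, Rinv_0_lt_compat; auto).
  apply Rmult_le_reg_r with (INR (fact k)); auto.
  rewrite Rmult_assoc, Rinv_l, Rmult_1_r by lra.
  apply Rle_trans with (1 := hb k 0 ltac:(lra)).
  apply Rmult_le_compat_r; [lra|]; apply Rmult_le_compat_l; auto.
  apply pow_incr; lra.
- intros p hp.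
  assert (hp1 : Rabs p < 1).
  { apply Rlt_le_trans with (1 := hp); rewrite <- Rinv_1.
    apply Rinv_le_contravar; lra. }
  assert (hq : B * Rabs p < 1).
  { assert (h0 := Rabs_pos p).
    apply (Rmult_lt_compat_l (B + 1)) in hp; [|lra].
    rewrite Rinv_r in hp; lra. }
  assert (hr : forall n, Rabs (f p - sum_f_R0 (fun k => a k * p ^ k) n)
     <= M * (B * Rabs p) ^ S n).
  { intros n; destruct (Rtotal_order p 0) as [h|[h|h]].
    - rewrite (Rabs_left p) in hp1 |- * by easy.
      (* Taylor's formula is stated to the right of 0: reflect f. *)
      set (g := fun x => f (- x)).
      assert (hloc : forall k x, locally (- x)
        (fun y => forall j, (j <= k)%nat -> ex_derive_n f j y)).
      { intros k x; apply filter_forall; auto. }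
      replace (f p) with (g (- p)) by (unfold g; f_equal; ring).
      replace (sum_f_R0 (fun k => a k * p ^ k) n) with
        (sum_f_R0 (fun k => (- p) ^ k / INR (fact k) * Derive_n g k 0) n).
      + apply taylor_remainder; [| |lra].
        * intros k x; now apply ex_derive_n_comp_opp.
        * intros k x hx; unfold g; rewrite Derive_n_comp_opp by apply hloc.
          rewrite Rabs_mult, pow_1_abs, Rmult_1_l; apply hb; lra.
      + apply sum_eq; intros k _; unfold g; rewrite Derive_n_comp_opp by apply hloc.
        rewrite Ropp_0; unfold a.
        replace (p ^ k) with ((-1) ^ k * (- p) ^ k); [field; apply INR_fact_neq_0|].
        rewrite <- Rpow_mult_distr; f_equal; ring.
    - subst p; rewrite Rabs_R0.
      replace (sum_f_R0 (fun k => a k * 0 ^ k) n) with (f 0).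
      + rewrite Rminus_diag, Rabs_R0, Rmult_0_r; simpl; lra.
      + symmetry; transitivity (sum_f_R0 (fun k => if Nat.eqb k 0 then f 0 else 0) n).
        * apply sum_eq; intros [|k] _; simpl; unfold a; simpl; [field|ring].
        * induction n as [|n IH]; [easy|]; rewrite tech5, IH; simpl; ring.
    - rewrite (Rabs_right p) in hp1 |- * by lra.
      replace (sum_f_R0 (fun k => a k * p ^ k) n) with
        (sum_f_R0 (fun k => p ^ k / INR (fact k) * Derive_n f k 0) n).
      + apply taylor_remainder; auto; lra.
      + apply sum_eq; intros k _; unfold a; field; apply INR_fact_neq_0. }
  symmetry; apply is_pseries_unique, is_pseries_R.
  change (is_lim_seq (sum_n (fun k => a k * p ^ k)) (f p)).
  apply (is_lim_seq_ext (sum_f_R0 (fun k => a k * p ^ k))).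
  { intros n; now rewrite <- sum_n_Reals. }
  apply is_lim_seq_spec; intros eps.
  assert (hlim : is_lim_seq (fun n => M * (B * Rabs p) ^ S n) 0).
  { replace 0 with (M * 0) by ring; apply (is_lim_seq_scal_l _ M 0).
    apply (is_lim_seq_incr_1 (fun n => (B * Rabs p) ^ n)), is_lim_seq_geom.
    rewrite Rabs_right; auto; apply Rle_ge, Rmult_le_pos; auto using Rabs_pos. }
  apply is_lim_seq_spec in hlim; destruct (hlim eps) as (N & hN).
  exists N; intros n hn; rewrite Rabs_minus_sym.
  apply Rle_lt_trans with (1 := hr n).
  apply Rle_lt_trans with (2 := hN n hn); rewrite Rminus_0_r; apply Rle_abs.
Qed.

(** With M >= 1 bounding the generators on [-1, 1], a polynomial of degree
    e + n d is at most M^(e + n d) times its size there, so the n-th derivative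
    of f grows at most like n! times a geometric sequence. *)
Theorem differential_ring_analytic (l : list (R -> R)) :
  (forall v, In v l -> derivable_in l v) ->
  forall f, in_ring l f ->
    smooth (fun _ => True) f /\
    exists a M B, 0 < B /\ (forall k, Rabs (a k) <= M * B ^ k) /\
      forall p, Rabs p < / B -> f p = PSeries a p.
Proof.
intros hl f hf.
assert (sf : smooth (fun _ => True) f).
{ intros n; revert f hf; induction n as [|n IH]; intros f hf; [easy|].
  destruct (derivable_in_ring l l (incl_refl l) hl f hf) as (f' & df & rf).
  apply Cn_intro with f'; auto; apply open_true. }
split; auto.
destruct (derivable_in_uniform l l hl) as (d & A & hA & hd).
destruct (bounded_uniform l (-1) 1) as (M & hM & hb); [lra| |].
{ intros v hv x; destruct (hl v hv) as (v' & dv & _); now exists (v' x). }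
destruct hf as (e & c & pf).
assert (hc := poly_norm_pos _ _ _ _ pf).
set (B := A * INR (e + d) * M ^ d).
assert (hB : 0 <= B).
{ apply Rmult_le_pos; [apply Rmult_le_pos; auto; apply pos_INR|apply pow_le; lra]. }
destruct (derivative_bounds_analytic f (c * M ^ e) B hB) as [h1 h2].
- intros n x; now apply Cn_ex_derive_n with (fun _ => True).
- intros n x hx.
  destruct (poly_Derive_n l d A hA hd e c f pf n) as (fn & -> & pn).
  apply Rle_trans with
    (1 := poly_bound l _ _ fn (fun x => -1 <= x <= 1) M hM hb pn x hx).
  unfold B; rewrite (Rpow_mult_distr _ (M ^ d)), pow_add, <- pow_mult, (Nat.mul_comm d n).
  apply Req_le; ring.
- exists (fun k => Derive_n f k 0 / INR (fact k)), (c * M ^ e), (B + 1).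
  split; [lra|auto].
Qed.

(** * The polar equation of a star-like periodic orbit *)

(** The quotient of the two speeds is the slope of the curve
    t |-> (Theta t, r t). By the intermediate value theorem, every angle near
    Theta t0 is Theta t for some t at distance at most proportional to the
    variation of the angle; this replaces the differentiability of an inverse
    of Theta. *)
Lemma is_derive_param_pos (F r Theta : R -> R) (t0 a b e : R) :
  0 < e -> 0 < a ->
  (forall t, Rabs (t - t0) < e -> F (Theta t) = r t /\ ex_derive Theta t) ->
  is_derive Theta t0 a -> is_derive r t0 b ->
  is_derive F (Theta t0) (b / a).
Proof.
intros he ha hF dT dr.
(* Subtracting (b/a) Theta reduces to a curve of slope 0. *)
assert (dm : is_derive (fun t => r t - b / a * Theta t) t0 0).
{ replace 0 with (minus b (scal (b / a) a)) by
    (unfold minus, plus, opp, scal; simpl; unfold mult; simpl; field; lra).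
  apply (is_derive_minus r (fun t => b / a * Theta t)); auto.
  apply (is_derive_scal Theta); auto. }
apply is_derive_Reals in dT; apply is_derive_Reals in dm.
apply is_derive_Reals; intros eps heps.
destruct (dT (a / 2)) as ([d1 hd1] & h1); [lra|].
destruct (dm (eps * a / 4)) as ([d2 hd2] & h2); [nra|].
simpl in h1, h2.
set (h0 := Rmin e (Rmin d1 d2) / 2).
assert (hh0 : 0 < h0 /\ h0 < e /\ h0 < d1 /\ h0 < d2).
{ assert (0 < Rmin e (Rmin d1 d2)) by (repeat apply Rmin_pos; auto).
  assert (q1 := Rmin_l e (Rmin d1 d2)); assert (q2 := Rmin_r e (Rmin d1 d2)).
  assert (q3 := Rmin_l d1 d2); assert (q4 := Rmin_r d1 d2).
  unfold h0; lra. }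
assert (inc : forall h, h <> 0 -> Rabs h <= h0 ->
  Rabs (Theta (t0 + h) - Theta t0 - a * h) < a / 2 * Rabs h).
{ intros h hn hh; replace (Theta (t0 + h) - Theta t0 - a * h) with
    (((Theta (t0 + h) - Theta t0) / h - a) * h) by now field.
  rewrite Rabs_mult; apply Rmult_lt_compat_r; [now apply Rabs_pos_lt|].
  apply h1; auto; lra. }
assert (hk0 : 0 < a * h0 / 2) by nra.
exists (mkposreal _ hk0); simpl; intros k hkn hk.
assert (ip := inc h0 ltac:(lra)); assert (im := inc (- h0) ltac:(lra)).
rewrite Rabs_Ropp in im; rewrite Rabs_right in ip, im by lra.
specialize (ip ltac:(lra)); specialize (im ltac:(lra)).
apply Rabs_def2 in ip; apply Rabs_def2 in im; apply Rabs_def2 in hk.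
destruct (f_interv_is_interv Theta (t0 + - h0) (t0 + h0) (Theta t0 + k))
  as (t & ht & et); [lra|lra| |].
{ intros t ht; apply continuity_pt_filterlim, (ex_derive_continuous Theta t).
  apply hF; apply Rabs_def1; lra. }
set (h := t - t0); replace t with (t0 + h) in et by (unfold h; ring).
assert (hh : Rabs h <= h0) by (apply Rabs_le; unfold h; lra).
assert (hn : h <> 0) by (intros h0'; rewrite h0', Rplus_0_r in et; lra).
assert (hhp : 0 < Rabs h) by now apply Rabs_pos_lt.
assert (hkh : a / 2 * Rabs h <= Rabs k).
{ specialize (inc h hn hh); rewrite et in inc.
  assert (hr := Rabs_triang_inv (a * h) k).
  rewrite Rabs_mult, (Rabs_right a), (Rabs_minus_sym _ k) in hr by lra.
  replace (Theta t0 + k - Theta t0 - a * h) with (k - a * h) in inc by ring; lra. }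
destruct (hF (t0 + h)) as [e1 _].
{ replace (t0 + h - t0) with h by ring; lra. }
destruct (hF t0) as [e0 _]; [rewrite Rminus_diag, Rabs_R0; easy|].
rewrite et in e1; rewrite e1, e0.
specialize (h2 h hn ltac:(lra)).
rewrite et, Rminus_0_r in h2.
replace ((r (t0 + h) - r t0) / k - b / a) with
  ((r (t0 + h) - b / a * (Theta t0 + k) - (r t0 - b / a * Theta t0)) / h * h / k)
  by (field; repeat split; auto; lra).
unfold Rdiv at 1; rewrite 2!Rabs_mult, Rabs_inv.
assert (hkp := Rabs_pos_lt k hkn).
apply Rmult_lt_reg_r with (Rabs k); auto.
rewrite Rmult_assoc, Rinv_l, Rmult_1_r by lra.
apply Rlt_trans with (eps * a / 4 * Rabs h); [now apply Rmult_lt_compat_r|].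
apply Rlt_le_trans with (eps * (a / 2 * Rabs h)).
{ assert (0 < eps * a * Rabs h) by (repeat apply Rmult_lt_0_compat; auto); lra. }
apply Rmult_le_compat_l; lra.
Qed.

Lemma is_derive_param (F r Theta : R -> R) (t0 a b e : R) :
  0 < e -> a <> 0 ->
  (forall t, Rabs (t - t0) < e -> F (Theta t) = r t /\ ex_derive Theta t) ->
  is_derive Theta t0 a -> is_derive r t0 b ->
  is_derive F (Theta t0) (b / a).
Proof.
intros he ha hF dT dr.
destruct (Rlt_dec 0 a) as [pa|na].
{ now apply is_derive_param_pos with r e. }
assert (flip : forall (f : R -> R) (t l : R), is_derive f (- t) l ->
  is_derive (fun t => f (- t)) t (- l)).
{ intros f t l hf; auto_derive; [now exists l|].
  rewrite (is_derive_unique (fun x : R => f x) _ _ hf); ring. }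
replace (b / a) with ((- b) / (- a)) by (field; lra).
replace (Theta t0) with (Theta (- (- t0))) by (f_equal; ring).
apply (is_derive_param_pos F (fun t => r (- t)) (fun t => Theta (- t)) (- t0) _ _ e).
- easy.
- lra.
- intros t ht; destruct (hF (- t)) as [e1 [l hl]].
  { rewrite <- Rabs_Ropp; replace (- (- t - t0)) with (t - - t0) by ring; easy. }
  split; auto; exists (- l); now apply flip.
- apply flip; now rewrite Ropp_involutive.
- apply flip; now rewrite Ropp_involutive.
Qed.

Lemma periodic_IZR (F : R -> R) (P : R) :
  (forall t, F (t + P) = F t) -> forall (k : Z) t, F (t + IZR k * P) = F t.
Proof.
intros hF k; induction k as [|k IH|k IH] using Z.peano_ind; intros t.
- f_equal; ring.
- rewrite <- (IH t), <- (hF (t + IZR k * P)), succ_IZR; f_equal; ring.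
- rewrite <- (IH t), <- (hF (t + IZR (Z.pred k) * P)); f_equal.
  unfold Z.pred; rewrite plus_IZR; ring.
Qed.

Lemma periodic_of_circle (F : R -> R) u v :
  (forall t, F (t + 2 * PI) = F t) ->
  cos u = cos v -> sin u = sin v -> F u = F v.
Proof.
intros hF hc hs.
assert (h : sin ((u - v) / 2) = 0).
{ assert (h1 : cos (u - v) = 1).
  { rewrite cos_minus, hc, hs; assert (h := sin2_cos2 v).
    unfold Rsqr in h; lra. }
  replace (u - v) with (2 * ((u - v) / 2)) in h1 by field.
  rewrite cos_2a_sin in h1; nra. }
destruct (sin_eq_0_0 _ h) as [k hk].
rewrite <- (periodic_IZR F _ hF k v); f_equal.
replace (IZR k * (2 * PI)) with (2 * (IZR k * PI)) by ring; rewrite <- hk; field.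
Qed.

Lemma atan_half_plane (x : R) :
  0 < cos x -> cos (atan (sin x / cos x)) = cos x /\
    sin (atan (sin x / cos x)) = sin x.
Proof.
intros hc.
assert (e : sqrt (1 + (sin x / cos x)²) = / cos x).
{ replace (1 + (sin x / cos x)²) with ((/ cos x) * (/ cos x)).
  - apply sqrt_square, Rlt_le, Rinv_0_lt_compat; easy.
  - assert (h := sin2_cos2 x); unfold Rsqr in *.
    field_simplify_eq; [|lra]; nra. }
rewrite cos_atan, sin_atan, e; split; field; lra.
Qed.

(** [radial] is the speed of r along the flow and [angular] is r times the
    speed of theta; without the division they remain polynomial in r, cos theta
    and sin theta. *)
Definition radial (X Y : R -> R -> R) (r theta : R) : R :=
  cos theta * X (r * cos theta) (r * sin theta)
  + sin theta * Y (r * cos theta) (r * sin theta).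

Definition angular (X Y : R -> R -> R) (r theta : R) : R :=
  cos theta * Y (r * cos theta) (r * sin theta)
  - sin theta * X (r * cos theta) (r * sin theta).

Definition polar_solution (X Y : R -> R -> R) (F : R -> R) : Prop :=
  forall theta, angular X Y (F theta) theta <> 0 /\
    is_derive F theta
      (F theta * radial X Y (F theta) theta / angular X Y (F theta) theta).

Lemma angular_neq0 X Y G F :
  star_like X Y G -> polar_curve F G ->
  forall theta, angular X Y (F theta) theta <> 0.
Proof.
intros hs (Fpos & _ & hG) theta h.
apply (hs (F theta * cos theta) (F theta * sin theta)).
- apply hG; now exists theta.
- unfold angular in h; unfold angular_speed.
  match goal with |- ?n / _ = 0 => replace n with
   (F theta * (cos theta * Y (F theta * cos theta) (F theta * sin theta)
    - sin theta * X (F theta * cos theta) (F theta * sin theta))) by ring end.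
  rewrite h; unfold Rdiv; ring.
Qed.

(** The angle along the orbit is only needed near the time t0 at which the
    orbit is at angle th0. In the frame rotated by th0 the orbit has coordinates
    A > 0 and B near t0, so the angle is th0 + atan (B / A). *)
Theorem polar_equation X Y G F :
  periodic_orbit X Y G -> star_like X Y G -> polar_curve F G ->
  polar_solution X Y F.
Proof.
intros (x & y & _ & sol & _ & _ & _ & orb) hs hF th0.
assert (W0 := angular_neq0 X Y G F hs hF th0).
split; [exact W0|].
destruct hF as (Fpos & Fper & hG).
destruct (proj1 (orb (F th0 * cos th0, F th0 * sin th0))) as [t0 ht0].
{ apply hG; now exists th0. }
injection ht0; intros ey ex; clear ht0; symmetry in ex, ey.
set (c := cos th0) in *; set (s := sin th0) in *.
assert (cs : c * c + s * s = 1).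
{ assert (h := sin2_cos2 th0); unfold Rsqr in h; unfold c, s; lra. }
assert (F0 := Fpos th0).
assert (dx : forall t, is_derive x t (X (x t) (y t))) by apply sol.
assert (dy : forall t, is_derive y t (Y (x t) (y t))) by apply sol.
set (A := fun t => x t * c + y t * s).
set (B := fun t => y t * c - x t * s).
(* A and B are r cos (theta - th0) and r sin (theta - th0) along the orbit. *)
assert (A0 : A t0 = F th0).
{ unfold A; rewrite ex, ey; transitivity (F th0 * (c * c + s * s));
    [ring|rewrite cs; ring]. }
assert (B0 : B t0 = 0) by (unfold B; rewrite ex, ey; ring).
assert (dA : forall t, is_derive A t (X (x t) (y t) * c + Y (x t) (y t) * s)).
{ intros t; unfold A; auto_derive.
  - split; [eexists; apply dx|split; [eexists; apply dy|easy]].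
  - rewrite (is_derive_unique (fun u : R => x u) _ _ (dx t)), (is_derive_unique (fun u : R => y u) _ _ (dy t)); ring. }
assert (dB : forall t, is_derive B t (Y (x t) (y t) * c - X (x t) (y t) * s)).
{ intros t; unfold B; auto_derive.
  - split; [eexists; apply dy|split; [eexists; apply dx|easy]].
  - rewrite (is_derive_unique (fun u : R => x u) _ _ (dx t)), (is_derive_unique (fun u : R => y u) _ _ (dy t)); ring. }
assert (hA : locally t0 (fun t => 0 < A t)).
{ assert (hc : continuous A t0) by (apply (ex_derive_continuous A); eexists; apply dA).
  apply hc, (open_gt 0); rewrite A0; easy. }
destruct hA as [e hA].
set (Theta := fun t => th0 + atan (B t / A t)).
assert (dT : forall t, 0 < A t -> is_derive Theta t
  ((Derive B t * A t - B t * Derive A t) / (A t * A t + B t * B t))).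
{ intros t ht; unfold Theta; auto_derive.
  - split; [eexists; apply dB|split; [eexists; apply dA|split; [lra|easy]]].
  - change (Derive (fun u : R => A u)) with (Derive A); change (Derive (fun u : R => B u)) with (Derive B);
    unfold Rsqr; field; nra. }
assert (T0 : Theta t0 = th0) by (unfold Theta; rewrite B0; unfold Rdiv;
  rewrite Rmult_0_l, atan_0; ring).
assert (W1 : Derive B t0 = angular X Y (F th0) th0).
{ rewrite (is_derive_unique _ _ _ (dB t0)), ex, ey; unfold angular; fold c s; ring. }
rewrite <- T0 at 1.
replace (F th0 * radial X Y (F th0) th0 / angular X Y (F th0) th0) with
  (radial X Y (F th0) th0 /
   ((Derive B t0 * A t0 - B t0 * Derive A t0) / (A t0 * A t0 + B t0 * B t0))).
2:{ rewrite W1, A0, B0; field; lra. }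
apply (is_derive_param F (fun t => sqrt (x t * x t + y t * y t)) Theta t0 _ _ e).
- apply cond_pos.
- rewrite W1, A0, B0; apply Rmult_integral_contrapositive_currified.
  + replace (_ - _) with (angular X Y (F th0) th0 * F th0) by ring.
    apply Rmult_integral_contrapositive_currified; lra.
  + apply Rinv_neq_0_compat; nra.
- intros t ht; assert (At : 0 < A t) by now apply hA.
  split; [|eexists; now apply dT].
  destruct (proj1 (hG (x t) (y t))) as (th & ext & eyt).
  { apply orb; now exists t. }
  assert (Ft := Fpos th).
  assert (eA : A t = F th * cos (th - th0)).
  { unfold A; rewrite ext, eyt, cos_minus; fold c s; ring. }
  assert (eB : B t = F th * sin (th - th0)).
  { unfold B; rewrite ext, eyt, sin_minus; fold c s; ring. }
  assert (hc : 0 < cos (th - th0)) by (rewrite eA in At; nra).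
  destruct (atan_half_plane _ hc) as [h1 h2].
  assert (eq : B t / A t = sin (th - th0) / cos (th - th0)).
  { rewrite eA, eB; field; lra. }
  transitivity (F th).
  + apply (periodic_of_circle F); auto.
    * transitivity (cos (th0 + (th - th0))); [|f_equal; ring].
      unfold Theta; rewrite eq, !(cos_plus th0), h1, h2; easy.
    * transitivity (sin (th0 + (th - th0))); [|f_equal; ring].
      unfold Theta; rewrite eq, !(sin_plus th0), h1, h2; easy.
  + rewrite ext, eyt; replace (_ + _) with (F th * F th).
    * now rewrite sqrt_square by lra.
    * assert (h := sin2_cos2 th); unfold Rsqr in h.
      transitivity (F th * F th * (sin th * sin th + cos th * cos th));
        [rewrite h; ring|ring].
- apply dT; rewrite A0; easy.
- assert (rr : x t0 * x t0 + y t0 * y t0 = F th0 * F th0).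
  { rewrite ex, ey; transitivity (F th0 * F th0 * (c * c + s * s));
      [ring|rewrite cs; ring]. }
  auto_derive.
  + repeat split; try (eexists; apply dx); try (eexists; apply dy).
    rewrite rr; nra.
  + rewrite rr, sqrt_square by lra.
    rewrite (is_derive_unique (fun u : R => x u) _ _ (dx t0)), (is_derive_unique (fun u : R => y u) _ _ (dy t0)), ex, ey.
    unfold radial; fold c s; field; lra.
Qed.

(** * The half-angle chart *)

Lemma cos_2_atan p : cos (2 * atan p) = (1 - p * p) / (1 + p * p).
Proof.
rewrite cos_2a_cos, cos_atan; unfold Rsqr.
assert (h : 0 < 1 + p * p) by nra.
assert (hs := sqrt_lt_R0 _ h); assert (e := sqrt_sqrt (1 + p * p) ltac:(lra)).
field_simplify_eq; [|split; lra].
replace (sqrt (1 + p * p) ^ 2) with (sqrt (1 + p * p) * sqrt (1 + p * p)) by ring.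
rewrite e; ring.
Qed.

Lemma sin_2_atan p : sin (2 * atan p) = 2 * p / (1 + p * p).
Proof.
rewrite sin_2a, cos_atan, sin_atan; unfold Rsqr.
assert (h : 0 < 1 + p * p) by nra.
assert (hs := sqrt_lt_R0 _ h); assert (e := sqrt_sqrt (1 + p * p) ltac:(lra)).
rewrite <- e at 3; field; lra.
Qed.

Lemma half_angle psi :
  -1 < cos psi ->
  let p := sin psi / (1 + cos psi) in
  p * p = (1 - cos psi) / (1 + cos psi) /\
  cos (2 * atan p) = cos psi /\ sin (2 * atan p) = sin psi.
Proof.
intros hc p.
assert (e : p * p = (1 - cos psi) / (1 + cos psi)).
{ assert (h := sin2_cos2 psi); unfold Rsqr in h.
  unfold p; field_simplify_eq; [nra|lra]. }
split; [easy|rewrite cos_2_atan, sin_2_atan, e; unfold p].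
split; field; lra.
Qed.

(** With theta = alpha + 2 atan p, the speed 2 / (1 + p^2) of theta equals
    1 + cos (theta - alpha), which is a polynomial in cos theta and sin theta.
    This is why the four functions C, S, Phi and Q form a closed system. *)
Lemma chart_analytic X Y F alpha :
  polynomial2 X -> polynomial2 Y -> polar_solution X Y F ->
  let Phi := fun p => F (alpha + 2 * atan p) in
  smooth (fun _ => True) Phi /\
  exists a M B, 0 < B /\ (forall k, Rabs (a k) <= M * B ^ k) /\
    forall p, Rabs p < / B -> Phi p = PSeries a p.
Proof.
intros hX hY sol Phi.
set (theta := fun p => alpha + 2 * atan p).
set (C := fun p => cos (theta p)).
set (S := fun p => sin (theta p)).
set (W := fun p => angular X Y (Phi p) (theta p)).
set (N := fun p => radial X Y (Phi p) (theta p)).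
set (Q := fun p => / W p).
set (dth := fun p => 1 + (cos alpha * C p + sin alpha * S p)).
assert (dtheta : forall p, is_derive theta p (dth p)).
{ intros p; unfold theta; auto_derive; [easy|].
  unfold dth, C, S; rewrite <- cos_minus, Rmult_1_l.
  rewrite <- cos_neg.
  replace (- (alpha - theta p)) with (2 * atan p) by (unfold theta; ring).
  rewrite cos_2_atan; unfold Rsqr; field; nra. }
set (l := C :: S :: Phi :: nil).
set (l' := Q :: l).
assert (inN : forall k, incl l k -> in_ring k N).
{ intros k hk.
  assert (rC : in_ring k C) by (apply in_ring_gen, hk; simpl; auto).
  assert (rS : in_ring k S) by (apply in_ring_gen, hk; simpl; auto).
  assert (rP : in_ring k Phi) by (apply in_ring_gen, hk; simpl; auto).
  assert (rx := in_ring_mult k _ _ rP rC); assert (ry := in_ring_mult k _ _ rP rS).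
  apply in_ring_plus; apply in_ring_mult; auto;
    now apply (in_ring_polynomial2 k _ (fun p => Phi p * C p) (fun p => Phi p * S p)). }
assert (inW : in_ring l W).
{ assert (rC : in_ring l C) by (apply in_ring_gen; simpl; auto).
  assert (rS : in_ring l S) by (apply in_ring_gen; simpl; auto).
  assert (rP : in_ring l Phi) by (apply in_ring_gen; simpl; auto).
  assert (rx := in_ring_mult l _ _ rP rC); assert (ry := in_ring_mult l _ _ rP rS).
  apply in_ring_ext with (fun p => C p * Y (Phi p * C p) (Phi p * S p)
    + (-1) * (S p * X (Phi p * C p) (Phi p * S p))).
  { intros p; unfold W, angular, C, S; ring. }
  apply in_ring_plus; [|apply in_ring_mult; [apply in_ring_const|]];
    apply in_ring_mult; auto;
    now apply (in_ring_polynomial2 l _ (fun p => Phi p * C p) (fun p => Phi p * S p)). }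
assert (rC : in_ring l' C) by (apply in_ring_gen; simpl; auto).
assert (rS : in_ring l' S) by (apply in_ring_gen; simpl; auto).
assert (rP : in_ring l' Phi) by (apply in_ring_gen; simpl; auto).
assert (rQ : in_ring l' Q) by (apply in_ring_gen; simpl; auto).
assert (rd : in_ring l' dth).
{ apply in_ring_plus; [apply in_ring_const|].
  apply in_ring_plus; apply in_ring_mult; auto using in_ring_const. }
assert (dl : forall v, In v l -> derivable_in l' v).
{ intros v [<-|[<-|[<-|[]]]].
  - exists (fun p => dth p * (-1 * S p)); split.
    + intros p; unfold C.
      replace (dth p * (-1 * S p)) with (dth p * (- sin (theta p))) by (unfold S; ring).
      apply (is_derive_comp cos theta); [apply is_derive_cos|apply dtheta].
    + repeat apply in_ring_mult; auto using in_ring_const.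
  - exists (fun p => dth p * C p); split.
    + intros p; apply (is_derive_comp sin theta); [apply is_derive_sin|apply dtheta].
    + now apply in_ring_mult.
  - exists (fun p => dth p * (Phi p * N p * Q p)); split.
    + intros p; apply (is_derive_comp F theta); [apply sol|apply dtheta].
    + repeat apply in_ring_mult; auto.
      apply inN; intros v hv; now right. }
assert (hl : incl l l') by (intros v hv; now right).
apply (differential_ring_analytic l'); [|easy].
intros v [<-|hv]; [|now apply dl].
destruct (derivable_in_ring l l' hl dl W inW) as (W' & dW & rW').
exists (fun p => (-1) * (W' p * (Q p * Q p))); split.
- intros p; assert (W0 : W p <> 0) by apply sol.
  replace (-1 * (W' p * (Q p * Q p))) with (- W' p / W p ^ 2)
    by (unfold Q; field; easy).
  apply (is_derive_inv W); auto.
- repeat apply in_ring_mult; auto using in_ring_const.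
Qed.

(** Smoothness holds beyond u = 1, that is past the point theta = alpha where
    cos (theta - alpha) folds the circle. *)
Lemma arc_form X Y F alpha :
  polynomial2 X -> polynomial2 Y -> polar_solution X Y F ->
  (forall theta, F (theta + 2 * PI) = F theta) ->
  exists (f g : R -> R) (d : R), 0 < d /\
    smooth (fun u => -1 < u < 1 + d) f /\ smooth (fun u => -1 < u < 1 + d) g /\
    forall theta, -1 < cos (theta - alpha) ->
      F theta = f (cos (theta - alpha)) + g (cos (theta - alpha)) * sin (theta - alpha).
Proof.
intros hX hY sol Fper.
destruct (chart_analytic X Y F alpha hX hY sol) as (sPhi & a & M & B & hB & ha & hPhi).
destruct (even_odd_parts _ a M B sPhi hB ha hPhi) as (H & K & d & hd & sH & sK & e).
set (w := fun u => (1 + (-1) * u) / (1 + u)).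
assert (oU : open (fun u => -1 < u < 1 + d)) by apply open_Ioo.
assert (hw : forall u, -1 < u < 1 + d -> - d < w u).
{ intros u hu; unfold w; apply Rmult_lt_reg_r with (1 + u); [lra|].
  unfold Rdiv; rewrite Rmult_assoc, Rinv_l, Rmult_1_r by lra; nra. }
assert (s1 : forall n, Cn n (fun u => -1 < u < 1 + d) (fun u => 1 + u)).
{ intros n; apply Cn_plus; auto using Cn_const, Cn_id. }
assert (sw : forall n, Cn n (fun u => -1 < u < 1 + d) w).
{ intros n; apply Cn_div; auto; [intros u hu; lra|].
  apply Cn_plus; auto using Cn_const; apply Cn_mult; auto using Cn_const, Cn_id. }
exists (fun u => H (w u)), (fun u => K (w u) / (1 + u)), d.
split; [easy|split; [|split]].
- intros n; apply (Cn_comp n _ (fun w => - d < w) H w); auto.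
- intros n; apply Cn_div; auto; [intros u hu; lra|].
  apply (Cn_comp n _ (fun w => - d < w) K w); auto.
- intros theta hc; destruct (half_angle _ hc) as (hp & ec & es).
  set (p := sin (theta - alpha) / (1 + cos (theta - alpha))) in *.
  transitivity (F (alpha + 2 * atan p)).
  + apply periodic_of_circle; auto.
    * transitivity (cos (alpha + (theta - alpha))); [f_equal; ring|].
      now rewrite !(cos_plus alpha), ec, es.
    * transitivity (sin (alpha + (theta - alpha))); [f_equal; ring|].
      now rewrite !(sin_plus alpha), ec, es.
  + rewrite e, hp; unfold w.
    replace (1 + -1 * cos (theta - alpha)) with (1 - cos (theta - alpha)) by ring.
    unfold p; field; lra.
Qed.

(** * The decomposition of F *)

(** The angles asin s and PI - asin s have the same sine and opposite cosines,
    which gives two independent equations for the two values at s. *)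
Lemma sin_cos_form_unique (f g f1 g1 : R -> R) :
  (forall theta, -1 < sin theta < 1 ->
     f (sin theta) + g (sin theta) * cos theta
     = f1 (sin theta) + g1 (sin theta) * cos theta) ->
  forall s, -1 < s < 1 -> f1 s = f s /\ g1 s = g s.
Proof.
intros h s hs.
assert (e : sin (asin s) = s) by (apply sin_asin; lra).
assert (hc : 0 < cos (asin s)).
{ assert (hb := asin_bound_lt s hs); apply cos_gt_0; lra. }
assert (h1 := h (asin s)); assert (h2 := h (PI - asin s)).
replace (cos (PI - asin s)) with (- cos (asin s)) in h2
  by (rewrite cos_minus, cos_PI, sin_PI; ring).
rewrite sin_PI_x, !e in h2; rewrite !e in h1.
specialize (h1 hs); specialize (h2 hs).
split; [lra|].
apply Rmult_eq_reg_r with (cos (asin s)); lra.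
Qed.

Lemma continuous_eq_closed (f g : R -> R) s :
  (forall s, -1 < s < 1 -> f s = g s) ->
  continuous f s -> continuous g s -> -1 <= s <= 1 -> f s = g s.
Proof.
intros h cf cg hs.
destruct (Req_dec (f s - g s) 0) as [h0|h0]; [lra|exfalso].
assert (c : continuous (fun t => f t - g t) s) by now apply (continuous_minus f g).
destruct (c _ (open_neq 0 _ h0)) as [e he].
assert (ep := cond_pos e).
set (r := Rmin (1 / 2) (e / 2)).
assert (hr : 0 < r <= 1 / 2 /\ r <= e / 2).
{ assert (q1 := Rmin_l (1 / 2) (e / 2)); assert (q2 := Rmin_r (1 / 2) (e / 2)).
  assert (0 < r) by (apply Rmin_pos; lra); unfold r in *; lra. }
apply (he (s * (1 - r))).
- change (Rabs (s * (1 - r) - s) < e); apply Rabs_def1; nra.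
- rewrite h; [ring|nra].
Qed.

Lemma smooth_on_m1_1_continuous f s :
  smooth_on_m1_1 f -> -1 <= s <= 1 -> continuous f s.
Proof.
intros (U & _ & hU & h) hs; apply (ex_derive_continuous f), (h 1%nat), hU, hs.
Qed.

Lemma smooth_glue_ends (d1 d2 : R) (f1 f2 : R -> R) :
  0 < d1 -> 0 < d2 ->
  smooth (fun s => -1 < s < 1 + d1) f1 -> smooth (fun s => - 1 - d2 < s < 1) f2 ->
  (forall s, -1 < s < 1 -> f1 s = f2 s) ->
  smooth_on_m1_1 (fun s => if Rle_dec 0 s then f1 s else f2 s).
Proof.
intros h1 h2 s1 s2 e; exists (fun s => - 1 - d2 < s < 1 + d1).
split; [apply open_Ioo|split; [intros s hs; lra|]].
intros n s hs.
apply Cn_ex_derive_n with (fun s => (-1 < s < 1 + d1) \/ (- 1 - d2 < s < 1));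
  [|destruct (Rlt_dec s 1); lra].
apply Cn_union.
- apply Cn_ext with f1; auto; [apply open_Ioo|].
  intros t ht; destruct (Rle_dec 0 t); [easy|apply e; lra].
- apply Cn_ext with f2; auto; [apply open_Ioo|].
  intros t ht; destruct (Rle_dec 0 t); [symmetry; apply e; lra|easy].
Qed.

Lemma smooth_scal U c f :
  open U -> smooth U f -> smooth U (fun s => c * f s).
Proof. intros oU sf n; apply Cn_mult; auto using Cn_const. Qed.

Lemma smooth_reflect d f :
  smooth (fun u => -1 < u < 1 + d) f ->
  smooth (fun s => - 1 - d < s < 1) (fun s => f (-1 * s)).
Proof.
intros sf n; apply (Cn_comp n _ (fun u => -1 < u < 1 + d) f); auto.
- apply open_Ioo.
- intros s hs; lra.
- apply Cn_mult; auto using Cn_const, Cn_id, open_Ioo.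
Qed.

Theorem corollary2p5 (X Y : R -> R -> R)
  (hX : polynomial2 X) (hY : polynomial2 Y)
  (hX0 : X 0 0 = 0) (hY0 : Y 0 0 = 0)
  (G : R * R -> Prop)
  (hG : limit_cycle X Y G) (hstar : star_like X Y G)
  (F : R -> R) (hF : polar_curve F G) :
  exists f g : R -> R,
    sin_cos_form F f g /\
    forall f1 g1 : R -> R,
      sin_cos_form F f1 g1 ->
      forall s, -1 <= s <= 1 -> f1 s = f s /\ g1 s = g s.
Proof.
assert (sol := polar_equation X Y G F (proj1 hG) hstar hF).
assert (Fper := proj1 (proj2 hF)).
destruct (arc_form X Y F (PI / 2) hX hY sol Fper)
  as (f1 & g1 & d1 & hd1 & sf1 & sg1 & e1).
destruct (arc_form X Y F (- (PI / 2)) hX hY sol Fper)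
  as (f2 & g2 & d2 & hd2 & sf2 & sg2 & e2).
assert (r1 : forall theta, -1 < sin theta ->
  F theta = f1 (sin theta) + (-1 * g1 (sin theta)) * cos theta).
{ intros theta ht; specialize (e1 theta).
  rewrite cos_minus, sin_minus, cos_PI2, sin_PI2 in e1.
  replace (cos theta * 0 + sin theta * 1) with (sin theta) in e1 by ring.
  rewrite e1 by easy; ring. }
assert (r2 : forall theta, sin theta < 1 ->
  F theta = f2 (-1 * sin theta) + g2 (-1 * sin theta) * cos theta).
{ intros theta ht; specialize (e2 theta).
  rewrite cos_minus, sin_minus, cos_neg, sin_neg, cos_PI2, sin_PI2 in e2.
  replace (cos theta * 0 + sin theta * - (1)) with (-1 * sin theta) in e2 by ring.
  rewrite e2 by lra; ring. }
assert (agree : forall s, -1 < s < 1 ->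
  f1 s = f2 (-1 * s) /\ -1 * g1 s = g2 (-1 * s)).
{ apply (sin_cos_form_unique (fun s => f2 (-1 * s)) (fun s => g2 (-1 * s))
    f1 (fun s => -1 * g1 s)).
  intros theta ht; rewrite <- r1, <- r2; lra. }
set (f := fun s => if Rle_dec 0 s then f1 s else f2 (-1 * s)).
set (g := fun s => if Rle_dec 0 s then -1 * g1 s else g2 (-1 * s)).
assert (form : sin_cos_form F f g).
{ split; [|split].
  - apply (smooth_glue_ends d1 d2 f1 (fun s => f2 (-1 * s))); auto.
    + now apply smooth_reflect.
    + apply agree.
  - apply (smooth_glue_ends d1 d2 (fun s => -1 * g1 s) (fun s => g2 (-1 * s))); auto.
    + apply smooth_scal; auto; apply open_Ioo.
    + now apply smooth_reflect.
    + apply agree.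
  - intros theta; unfold f, g; destruct (Rle_dec 0 (sin theta)); [apply r1|apply r2]; lra. }
exists f, g; split; [exact form|].
intros f' g' (sf' & sg' & e') s hs.
destruct form as (sf & sg & e).
assert (u := sin_cos_form_unique f g f' g'
  (fun theta _ => eq_trans (eq_sym (e theta)) (e' theta))).
split.
- apply (continuous_eq_closed f' f s (fun t ht => proj1 (u t ht)));
    auto using smooth_on_m1_1_continuous.
- apply (continuous_eq_closed g' g s (fun t ht => proj2 (u t ht)));
    auto using smooth_on_m1_1_continuous.
Qed.
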